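(* Let $X$ be a real Banach space, $g:[a,b]\to X$, $x\in[a,b]$, and suppose that $md(g,x)>0$ and $md(g,\cdot)$ is continuous at $x$. Then $x$ is a metrically regular point of the function $g$.
   Context: For $g:[a,b]\to X$, the unilateral metric derivatives are $md_{\pm}(g,x)=\lim_{t\to0+}\frac{\|g(x\pm t)-g(x)\|}{t}$. If both exist and are equal (and finite), their common value is the metric derivative $md(g,x)$; at an endpoint of $[a,b]$ only the one-sided limit taken inside $[a,b]$ is used. ''$md(g,\cdot)$ is continuous at $x$'' means that $md(g,s)$ exists for all $s\in[a,b]$ in some neighbourhood of $x$ and $md(g,s)\to md(g,x)$ as $s\to x$, $s\in[a,b]$. $\bigvee_u^v g$ denotes the total variation of $g$ on $[u,v]$ for $u<v$, and $\bigvee_v^u g:=-\bigvee_u^v g$. A point $x\in[a,b]$ is a metrically regular point of $g$ if $\lim_{t\to0,\ x+t\in[a,b]}\frac{\|g(x+t)-g(x)\|}{\left|\bigvee_x^{x+t}g\right|}=1$ (in particular the denominator is nonzero for all small $t\neq0$). *)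

(* Defs.v *)
From HB Require Import structures.
From mathcomp Require Import all_boot all_order all_algebra.
From mathcomp Require Import all_classical all_reals all_analysis.

Set Implicit Arguments.
Unset Strict Implicit.
Unset Printing Implicit Defensive.

Import Order.TTheory GRing.Theory Num.Theory.
Import numFieldNormedType.Exports.

Local Open Scope classical_set_scope.
Local Open Scope ring_scope.

(* A map [a, b] -> X is represented by a function g : R -> X.  For a < b, every
   notion below depends only on the values of g on [a, b], at points of [a, b]. *)

Section MetricDerivative.
Context {R : realType} {X : normedModType R}.
Implicit Types (g : R -> X) (a b x t : R).

Definition right_quotient g x t : R := `|g (x + t) - g x| / t.
Definition left_quotient g x t : R := `|g (x - t) - g x| / t.

Definition md_right g x : R := lim (right_quotient g x t @[t --> 0^'+]).
Definition md_left g x : R := lim (left_quotient g x t @[t --> 0^'+]).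

(* Existence of md(g, x) for x in [a, b].  At an endpoint only the limit taken
   inside [a, b] is required.  Convergence is in R, so the limits are finite. *)
Definition has_md a b g x : Prop :=
  [/\ x < b -> cvg (right_quotient g x t @[t --> 0^'+]),
      a < x -> cvg (left_quotient g x t @[t --> 0^'+]) &
      a < x < b -> md_right g x = md_left g x].

(* Meaningful only under [has_md a b g x]. *)
Definition md b g x : R := if x < b then md_right g x else md_left g x.

Definition md_continuous_at a b g x : Prop :=
  (\forall s \near within `[a, b] (nbhs x), has_md a b g s) /\
  md b g s @[s --> within `[a, b] (nbhs x)] --> md b g x.

End MetricDerivative.

Section MetricRegularity.
Context {R : realType} {X : normedModType R}.
Implicit Types (g : R -> X) (a b u v x : R).

(* The library's [variation] and [total_variation] are restricted to R -> R.
   The partition of [u, v] is u followed by the points of s, the last being v. *)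
Definition variation_of u v g (s : seq R) : R :=
  let F := g \o nth v (u :: s) in
  \sum_(0 <= n < size s) `|F n.+1 - F n|.

Definition total_var u v g : \bar R :=
  ereal_sup [set (variation_of u v g s)%:E | s in itv_partition u v].

Definition signed_var u v g : \bar R :=
  if u <= v then total_var u v g else (- total_var v u g)%E.

(* The quotient is taken in \bar R, where r / +oo = 0, 0 / 0 = 0 and
   r / 0 = +oo for r > 0: limit 1 forces the denominator to be finite and
   nonzero for all small t != 0 with x + t in [a, b]. *)
Definition metrically_regular a b g x : Prop :=
  (`|g (x + t) - g x|%:E / `|signed_var x (x + t) g|)%E
    @[t --> within [set t | x + t \in `[a, b]] 0^'] --> 1%E.

End MetricRegularity.

(* Main.v *)
(* If md(g, .) < K near x, then g is K-Lipschitz near x, by a mean value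
   inequality proved by a supremum argument, hence the variation between x and
   x + t is at most K |t|.  It is at least |g(x + t) - g(x)|, which is at least
   k |t| for small t when k < md(g, x).  The quotient thus lies in [k / K, 1],
   and k, K can be taken arbitrarily close to md(g, x) > 0. *)

Require Import Defs.
From HB Require Import structures.
From mathcomp Require Import all_boot all_order all_algebra.
From mathcomp Require Import all_classical all_reals all_analysis.
From mathcomp Require Import ring lra.
Import Order.TTheory GRing.Theory Num.Theory.
Import numFieldNormedType.Exports.
Local Open Scope classical_set_scope.
Local Open Scope ring_scope.

Lemma lim_at_right0_bounds (R : realType) (f : R -> R) (k K : R) :
  cvg (f t @[t --> 0^'+]) -> k < lim (f t @[t --> 0^'+]) < K ->
  exists2 d, 0 < d & forall t, 0 < t < d -> k < f t < K.
Proof.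
move=> fl /andP[kl lK].
have : \forall t \near 0^'+, k < f t < K.
  near=> t; apply/andP; split; near: t.
    exact: (cvgr_gt _ fl).
  exact: (cvgr_lt _ fl).
case=> d /= d0 H; exists d => // t /andP[t0 td].
by apply: H => //=; rewrite sub0r normrN gtr0_norm.
Unshelve. all: by end_near. Qed.

Lemma has_md_bounds (R : realType) (X : normedModType R) (a b : R)
    (g : R -> X) (s k K : R) :
  a <= s <= b -> has_md a b g s -> k < md b g s < K ->
  exists2 d, 0 < d & forall t, a <= t <= b -> `|t - s| < d ->
    k * `|t - s| <= `|g t - g s| <= K * `|t - s|.
Proof.
move=> /andP[as_ sb] [cr cl rl] mdK.
have [d1 d10 H1] : exists2 d, 0 < d & s < b -> forall t, 0 < t < d ->
    k < right_quotient g s t < K.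
  have [sltb|] := ltP s b; last by exists 1.
  have [|d d0 H] := @lim_at_right0_bounds _ _ k K (cr sltb).
    by move: mdK; rewrite /md sltb.
  by exists d.
have [d2 d20 H2] : exists2 d, 0 < d & a < s -> forall t, 0 < t < d ->
    k < left_quotient g s t < K.
  have [alts|] := ltP a s; last by exists 1.
  have [|d d0 H] := @lim_at_right0_bounds _ _ k K (cl alts).
    move: mdK; rewrite /md; case: ifP => // sltb.
    by rewrite rl // alts.
  by exists d.
exists (Num.min d1 d2) => [|t /andP[at_ tb]]; rewrite lt_min; first exact/andP.
move=> /andP[td1 td2]; have [ts|st|->] := ltgtP t s.
- have h : `|t - s| = s - t by rewrite distrC gtr0_norm // subr_gt0.
  have := H2 (le_lt_trans at_ ts) (s - t).
  rewrite subr_gt0 ts -h td2 h /left_quotient subKr => /(_ isT).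
  by rewrite ltr_pdivlMr ?subr_gt0 // ltr_pdivrMr ?subr_gt0 // => /andP[/ltW + /ltW +] => -> ->.
- have h : `|t - s| = t - s by rewrite gtr0_norm // subr_gt0.
  have := H1 (lt_le_trans st tb) (t - s).
  rewrite h in td1 *; rewrite subr_gt0 st td1 /right_quotient subrKC => /(_ isT).
  by rewrite ltr_pdivlMr ?subr_gt0 // ltr_pdivrMr ?subr_gt0 // => /andP[/ltW + /ltW +] => -> ->.
- by rewrite !subrr !normr0 !mulr0 lexx.
Qed.

Lemma locally_lipschitz_le (R : realType) (X : normedModType R) (g : R -> X)
    (u v K : R) : u <= v ->
  (forall s, u <= s <= v -> exists2 d, 0 < d &
    forall t, u <= t <= v -> `|t - s| < d -> `|g t - g s| <= K * `|t - s|) ->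
  `|g v - g u| <= K * (v - u).
Proof.
move=> uv H.
pose S := [set t | u <= t <= v /\ `|g t - g u| <= K * (t - u)].
have Su : S u by rewrite /S /= lexx uv !subrr normr0 mulr0.
have Sv : ubound S v by move=> t [/andP[]].
have hS : has_sup S by split; [exists u|exists v].
have us : u <= sup S by apply: ub_le_sup => //; exists v.
have sv : sup S <= v by apply: ge_sup => //; exists u.
have usv : u <= sup S <= v by rewrite us.
have [d d0 Hd] := H _ usv.
have [t [utv tu]] := sup_adherent d0 hS.
move: (utv) => /andP[ut tv] dt.
have ts : t <= sup S by apply: ub_le_sup; [exists v|split].
have Ss : `|g (sup S) - g u| <= K * (sup S - u).
  have h : `|t - sup S| = sup S - t by rewrite distrC ger0_norm // subr_ge0.
  have := Hd t utv; rewrite h distrC => Ht.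
  apply: (le_trans (ler_distD (g t) _ _)).
  have -> : K * (sup S - u) = K * (sup S - t) + K * (t - u) by ring.
  by apply: lerD => //; apply: Ht; lra.
have [vs|sltv] := leP v (sup S).
  by have -> : v = sup S by apply/eqP; rewrite eq_le vs.
pose w := Num.min v (sup S + d / 2).
have sw : sup S < w by rewrite /w lt_min sltv ltrDl divr_gt0.
have wv : w <= v by rewrite /w ge_min lexx.
have wd : w <= sup S + d / 2 by rewrite /w ge_min lexx orbT.
have uwv : u <= w <= v by rewrite wv (le_trans us (ltW sw)).
suff : w <= sup S by rewrite leNgt sw.
apply: ub_le_sup; first by exists v.
split=> //.
apply: (le_trans (ler_distD (g (sup S)) _ _)).
have -> : K * (w - u) = K * (w - sup S) + K * (sup S - u) by ring.
have h : `|w - sup S| = w - sup S by rewrite gtr0_norm // subr_gt0.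
apply: lerD => //; rewrite -h; apply: Hd => //; rewrite h; lra.
Qed.

Lemma total_var_le (R : realType) (X : normedModType R) (g : R -> X)
    (u v K : R) :
  (forall s t, u <= s -> s <= t -> t <= v -> `|g t - g s| <= K * (t - s)) ->
  (total_var u v g <= (K * (v - u))%:E)%E.
Proof.
move=> H; apply: ge_ereal_sup => _ [s us <-]; rewrite lee_fin /variation_of.
have -> : v - u = \sum_(0 <= n < size s)
    (nth v (u :: s) n.+1 - nth v (u :: s) n).
  by rewrite telescope_sumr // (itv_partition_nth_size v us).
rewrite mulr_sumr; apply: ler_sum_nat => n /= ns.
apply: H.
- by apply: (itv_partition_nth_ge _ us); rewrite ltnS ltnW.
- exact: (nondecreasing_fun_itv_partition (f := id) _ us ns).
- exact: (@itv_partition_nth_le _ _ u v s n.+1).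
Qed.

Lemma total_var_ge (R : realType) (X : normedModType R) (g : R -> X)
    (u v : R) : u < v -> (`|g v - g u|%:E <= total_var u v g)%E.
Proof.
move=> uv; apply: ereal_sup_ubound; exists [:: v]; first exact: itv_partition1.
by rewrite /variation_of big_nat1.
Qed.

Lemma divEFin_between (R : realType) (N r k K : R) (V : \bar R) :
  0 < k -> 0 < r -> k * r <= N -> (N%:E <= V)%E -> (V <= (K * r)%:E)%E ->
  exists2 q : R, (N%:E / V)%E = q%:E & k / K <= q <= 1.
Proof.
move=> k0 r0 krN; case: V => [V| |] //.
rewrite !lee_fin => NV VK.
have kr0 : 0 < k * r by rewrite mulr_gt0.
have V0 : 0 < V by lra.
have K0 : 0 < K by rewrite -(pmulr_lgt0 _ r0); lra.
exists (N / V); first by rewrite inver gt_eqF.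
apply/andP; split; last by rewrite ler_pdivrMr // mul1r.
rewrite ler_pdivlMr // mulrAC ler_pdivrMr //.
have : k * V <= k * (K * r) by rewrite ler_pM2l.
have : K * (k * r) <= K * N by rewrite ler_pM2l.
lra.
Qed.

Theorem lemma4p3 (R : realType) (X : completeNormedModType R)
    (a b : R) (hab : a < b) (g : R -> X) (x : R) (hx : x \in `[a, b])
    (hmd : has_md a b g x) (hpos : 0 < md b g x)
    (hcont : md_continuous_at a b g x) :
  metrically_regular a b g x.
Proof.
have xab : a <= x <= b by move: hx; rewrite in_itv.
move: hcont => [near_md cvg_md].
rewrite /metrically_regular => P /nbhs_EFin /nbhs_ballP[e /= e0 He].
pose c := Num.min (e / 2) (1 / 2).
have c0 : 0 < c by rewrite lt_min; apply/andP; split; lra.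
have ce : c <= e / 2 by rewrite ge_min lexx.
have c1 : c <= 1 / 2 by rewrite ge_min lexx orbT.
set L := md b g x in hpos cvg_md.
pose k := L * (1 - c); pose K := L * (1 + c).
have cL : 0 < c * L by rewrite mulr_gt0.
have k0 : 0 < k by rewrite mulr_gt0 //; lra.
have K0 : 0 < K by rewrite mulr_gt0 //; lra.
have kL : k < L by rewrite /k; lra.
have LK : L < K by rewrite /K; lra.
have kK : 1 - e < k / K.
  rewrite ltr_pdivlMr // /k /K.
  have : L * ((1 - e) * (1 + c)) < L * (1 - c); last by lra.
  by rewrite ltr_pM2l //; nra.
have [d1 /= d10 H1] := near_md.
have [d2 /= d20 H2] := cvgr_lt _ cvg_md _ LK.
have [|d3 d30 H3] := has_md_bounds _ _ _ _ _ _ k K xab hmd; first by rewrite kL.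
have Hloc u v : a <= u -> u <= v -> v <= b -> (forall s, u <= s <= v ->
    `|x - s| < d1 /\ `|x - s| < d2) -> `|g v - g u| <= K * (v - u).
  move=> au uv vb Hs; apply: locally_lipschitz_le => // s usv.
  have [s1 s2] := Hs _ usv.
  move: (usv) => /andP[us sv].
  have sab : a <= s <= b by rewrite (le_trans au us) (le_trans sv vb).
  have m1 : has_md a b g s by apply: H1; rewrite //= in_itv.
  have m2 : md b g s < K by apply: H2; rewrite //= in_itv.
  have [|d d0 Hd] := has_md_bounds _ _ _ _ _ _ (md b g s - 1) K sab m1.
    by rewrite m2 andbT; lra.
  exists d => // t /andP[ut tv] td.
  have tab : a <= t <= b by rewrite (le_trans au ut) (le_trans tv vb).
  by have /andP[] := Hd t tab td.
apply/nbhs_ballP; exists (Num.min d1 (Num.min d2 d3)) => /=.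
  by rewrite !lt_min d10 d20.
move=> t; rewrite /ball /= sub0r normrN !lt_min => /and3P[t1 t2 t3] t0.
rewrite in_itv /= => xtab.
have tE : `|x + t - x| = `|t| by rewrite addrAC subrr add0r.
have near_x s : Num.min x (x + t) <= s <= Num.max x (x + t) ->
    `|x - s| < d1 /\ `|x - s| < d2.
  move=> h; suff : `|x - s| <= `|t| by move=> h'; split; apply: le_lt_trans h' _.
  rewrite ler_norml; move: h.
  by case: (ltgtP x (x + t)) => h /andP[h1 h2]; case: (ler0P t) => ?;
    apply/andP; split; lra.
have := H3 _ xtab; rewrite tE => /(_ t3) /andP[kN _].
move: xab xtab => /andP[ax xb] /andP[axt xtb].
have [VN VK] : (`|g (x + t) - g x|%:E <= `|signed_var x (x + t) g|)%E /\
    (`|signed_var x (x + t) g| <= (K * `|t|)%:E)%E.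
  have [tneg|tpos|t00] := ltgtP t 0; last by rewrite t00 eqxx in t0.
  - have xtx : x + t < x by lra.
    have := @total_var_ge R X g _ _ xtx; rewrite distrC => tvge.
    rewrite /signed_var (leNgt x) xtx /= abseN gee0_abs; last first.
      by apply: le_trans tvge; rewrite lee_fin.
    split => //; have -> : `|t| = x - (x + t) by rewrite ltr0_norm //; lra.
    apply: total_var_le => u v xu uv vx; apply: Hloc => //; try lra.
    move=> s /andP[us sv]; apply: near_x.
    by rewrite (min_idPr (ltW xtx)) (max_idPl (ltW xtx)); lra.
  - have xxt : x < x + t by lra.
    have tvge := @total_var_ge R X g _ _ xxt.
    rewrite /signed_var (ltW xxt) gee0_abs; last first.
      by apply: le_trans tvge; rewrite lee_fin.
    split => //; have -> : `|t| = (x + t) - x by rewrite gtr0_norm //; lra.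
    apply: total_var_le => u v xu uv vx; apply: Hloc => //; try lra.
    move=> s /andP[us sv]; apply: near_x.
    by rewrite (min_idPl (ltW xxt)) (max_idPr (ltW xxt)); lra.
have tpos : 0 < `|t| by rewrite normr_gt0.
have [q -> /andP[q1 q2]] := divEFin_between _ _ _ _ _ _ k0 tpos kN VN VK.
apply: He; rewrite /ball /= ger0_norm; lra.
Qed.
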